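(* Let $\Gamma$ be a graph in which, for some $u'\in V\Gamma$ and $v'\in\Gamma(u')$, the graph induced by $\Gamma(u')\cap\Gamma_2(v')$ is neither edgeless nor complete. If $\Gamma$ has the unique $x$ property, then $\Gamma$ is not $4$-CH.
   Context: All graphs are undirected and simple with non-empty vertex set $V\Gamma$ (possibly infinite). For $u\in V\Gamma$, $\Gamma_i(u)$ is the set of vertices at distance $i$ from $u$, and $\Gamma(u)=\Gamma_1(u)$. A non-complete graph $\Gamma$ has the unique $x$ property if for some $u\in V\Gamma$, $v\in\Gamma(u)$ and $w\in\Gamma_2(u)\cap\Gamma(v)$, there exists a unique $x\in\Gamma(u)\cap\Gamma_2(v)$ such that $\Gamma(u)\cap\Gamma(v)\cap\Gamma(w)=\Gamma(u)\cap\Gamma(v)\cap\Gamma(x)$. For a positive integer $k$, a graph $\Gamma$ is $k$-CH if any isomorphism between connected induced subgraphs of $\Gamma$ of order at most $k$ extends to an automorphism of $\Gamma$. *)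

(* Defs.v *)
From HB Require Import structures.
From mathcomp Require Import all_boot all_order.
From mathcomp Require Import boolp classical_sets functions cardinality.
Set Implicit Arguments.
Unset Strict Implicit.
Unset Printing Implicit Defensive.

Local Open Scope classical_set_scope.
Local Open Scope card_scope.

(* Simple undirected graphs, finite or infinite.  The record allows an empty
   vertex type, so that [induced] is defined on every vertex set;
   nonemptiness is required separately. *)
Record sgraph := SGraph {
  vertex :> Type;
  adj : vertex -> vertex -> Prop;
  adj_sym : forall x y, adj x y -> adj y x;
  adj_irrefl : forall x, ~ adj x x }.

Section Basic.
Variable G : sgraph.

Fixpoint walk (n : nat) (x y : G) : Prop :=
  if n is m.+1 then exists2 z, adj x z & walk m z y else x = y.

Definition at_dist (i : nat) (x y : G) : Prop :=
  walk i x y /\ forall j, (j < i)%N -> ~ walk j x y.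

Definition sphere (i : nat) (u : G) : set G := [set x | at_dist i u x].

Definition nbhd (u : G) : set G := sphere 1 u.

Definition complete_graph : Prop := forall x y : G, x <> y -> adj x y.

Definition edgeless_graph : Prop := forall x y : G, ~ adj x y.

Definition connected_graph : Prop :=
  inhabited G /\ forall x y : G, exists n, walk n x y.

Definition order_le (k : nat) : Prop := [set: G] #<= `I_k.

End Basic.

Arguments complete_graph : clear implicits.
Arguments edgeless_graph : clear implicits.
Arguments connected_graph : clear implicits.
Arguments order_le : clear implicits.

Definition induced (G : sgraph) (A : set G) : sgraph :=
  @SGraph (set_type A) (fun x y => adj (val x) (val y))
    (fun x y => @adj_sym G (val x) (val y)) (fun x => @adj_irrefl G (val x)).

Definition is_iso (G H : sgraph) (f : G -> H) : Prop :=
  bijective f /\ forall x y : G, adj x y <-> adj (f x) (f y).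

Definition is_aut (G : sgraph) (g : G -> G) : Prop := is_iso g.

Definition is_CH (k : nat) (G : sgraph) : Prop :=
  forall (A B : set G) (f : induced A -> induced B),
    connected_graph (induced A) -> connected_graph (induced B) ->
    order_le (induced A) k -> order_le (induced B) k ->
    is_iso f ->
    exists g : G -> G, is_aut g /\ forall x : induced A, g (val x) = val (f x).

Definition unique_x_property (G : sgraph) : Prop :=
  ~ complete_graph G /\
  exists u v w : G,
    nbhd u v /\ (sphere 2 u `&` nbhd v) w /\
    exists! x : G,
      (nbhd u `&` sphere 2 v) x /\
      nbhd u `&` nbhd v `&` nbhd w = nbhd u `&` nbhd v `&` nbhd x.

(* Main.v *)
(* Suppose the graph is 4-CH and let u, v, w, x witness the unique x property.
   For y <> x in X = Γ(u) ∩ Γ_2(v), an automorphism fixing u, v, w fixes x by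
   uniqueness, so it cannot map y to x; by 4-CH, y and x differ in their
   adjacency to w.  Hence all y <> x in X have the same adjacency to w and are
   permuted transitively by the stabiliser of u, v, w, which also fixes x.
   But X is vertex-transitive and neither edgeless nor complete, so x has both
   a neighbour and a non-neighbour in X. *)
Require Import Defs.
From HB Require Import structures.
From mathcomp Require Import all_boot all_order.
From mathcomp Require Import boolp classical_sets functions cardinality.

Local Open Scope classical_set_scope.

Set Implicit Arguments.
Unset Strict Implicit.

(** * Distances one and two in terms of adjacency *)

Section Distance.
Variable G : sgraph.

Lemma nbhdE (u x : G) : nbhd u x <-> adj u x.
Proof.
split=> [[[z uz e] _]|ux]; first by rewrite -[x]e.
split; first by exists x.
by case=> // _ /= eux; apply: (@adj_irrefl G u); rewrite {2}eux.
Qed.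

Lemma sphere2E (u x : G) :
  sphere 2 u x <-> [/\ u <> x, ~ adj u x & exists2 z, adj u z & adj z x].
Proof.
split=> [[[z uz [y zy eyx]] far]|[nux naux [z uz zx]]].
  split; last by exists z; rewrite -?eyx.
    exact: (far 0).
  by move=> ux; apply: (far 1) => //; exists x.
split; first by exists z => //; exists x.
by case=> [|[|]] //= _ [y uy eyx]; apply: naux; rewrite -eyx.
Qed.

(** Since [u] itself is a midpoint between [v] and [x], distance two only asks that [v] and [x] be
    distinct and non-adjacent, a condition visible in the induced subgraph. *)
Lemma nbhd_sphere2E (u v x : G) : adj u v ->
  (nbhd u `&` sphere 2 v) x <-> [/\ adj u x, v <> x & ~ adj v x].
Proof.
move=> uv; split=> [[/nbhdE ux /sphere2E[]]//|[ux nvx navx]].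
split; first exact/nbhdE.
by apply/sphere2E; split=> //; exists u => //; apply: adj_sym.
Qed.

Lemma not_edgeless_induced (A : set G) :
  ~ edgeless_graph (induced A) -> exists x y, [/\ A x, A y & adj x y].
Proof.
apply: contra_notP => no [x Ax] [y Ay] xy; apply: no.
by exists x, y; split=> //; apply: set_mem.
Qed.

Lemma not_complete_induced (A : set G) :
  ~ complete_graph (induced A) ->
  exists x y, [/\ A x, A y, x <> y & ~ adj x y].
Proof.
apply: contra_notP => no [x Ax] [y Ay] nxy; apply: contrapT => naxy; apply: no.
exists x, y; split=> //; try exact: set_mem.
by move=> exy; apply: nxy; apply: val_inj.
Qed.

End Distance.

(** * Invariance under automorphisms *)

Section Automorphism.
Variables (G : sgraph) (g : G -> G).
Hypothesis g_aut : is_aut g.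

Lemma aut_adj (x y : G) : adj (g x) (g y) = adj x y.
Proof. by apply/propext; split=> [/(g_aut.2 x y).2|/(g_aut.2 x y).1]. Qed.

Lemma aut_nbhd (x y : G) : nbhd (g x) (g y) = nbhd x y.
Proof.
by apply/propext; split=> /nbhdE h; apply/nbhdE; move: h; rewrite aut_adj.
Qed.

Lemma aut_inj : injective g.
Proof. exact: bij_inj g_aut.1. Qed.

Lemma aut_surj (y : G) : exists x, g x = y.
Proof. by case: g_aut => -[h _ gK] _; exists (h y). Qed.

Lemma aut_nbhd_sphere2 (u v x : G) : adj u v ->
  (nbhd u `&` sphere 2 v) x -> (nbhd (g u) `&` sphere 2 (g v)) (g x).
Proof.
move=> uv /(nbhd_sphere2E _ uv)[ux nvx navx].
apply/nbhd_sphere2E; rewrite !aut_adj //.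
by split=> // /aut_inj.
Qed.

Lemma aut_common_nbhd (u v w x : G) :
  nbhd u `&` nbhd v `&` nbhd w = nbhd u `&` nbhd v `&` nbhd x ->
  nbhd (g u) `&` nbhd (g v) `&` nbhd (g w) =
  nbhd (g u) `&` nbhd (g v) `&` nbhd (g x).
Proof.
move=> eC; apply/funext=> t; have [s <-] := aut_surj t.
by have := congr1 (@^~ s) eC; rewrite /setI /mkset !aut_nbhd.
Qed.

End Automorphism.

Lemma adj_neq (G : sgraph) (x y : G) : adj x y -> x <> y.
Proof. by move=> xy exy; apply: (@adj_irrefl G x); rewrite {2}exy. Qed.

Lemma walk_trans (G : sgraph) (m n : nat) (x y z : G) :
  walk m x y -> walk n y z -> walk (m + n) x z.
Proof.
elim: m x => [|m IH] x /=; first by move=> ->.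
by move=> [t xt ty] yz; exists t => //; apply: IH ty yz.
Qed.

Lemma walk_sym (G : sgraph) (n : nat) (x y : G) : walk n x y -> walk n y x.
Proof.
elim: n x => [|n IH] x //= [z xz /IH zy].
rewrite -/(walk n.+1 y x) -addn1.
by apply: walk_trans zy _; exists x => //; apply: adj_sym.
Qed.

(** * Homogeneity for tuples of vertices *)

Section Extension.
Variable G : sgraph.

Definition range_elt (n : nat) (a : 'I_n -> G) (i : 'I_n) : induced (range a) :=
  SigSub (mem_set (imageT a i)).

(** A chosen preimage; it inverts [range_elt] on both sides once [a] is injective. *)
Definition range_index (n : nat) (a : 'I_n -> G) (x : induced (range a)) :
    'I_n :=
  sval (cid2 (set_mem (valP x))).

Lemma range_indexK (n : nat) (a : 'I_n -> G) (x : induced (range a)) :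
  range_elt a (range_index x) = x.
Proof. by apply: val_inj; rewrite /= /range_index; case: cid2. Qed.

Lemma range_eltK (n : nat) (a : 'I_n -> G) :
  injective a -> cancel (range_elt a) (@range_index _ a).
Proof. by move=> aI i; apply: aI; rewrite /range_index; case: cid2. Qed.

Lemma range_order_le (n : nat) (a : 'I_n -> G) : order_le (induced (range a)) n.
Proof.
apply/pcard_leP/injfunPex; exists (fun x => range_index x : nat).
  by move=> x _; exact: ltn_ord.
move=> x y _ _ /val_inj exy.
by rewrite -(range_indexK x) exy range_indexK.
Qed.

(** Stepping repeatedly to an adjacent entry of smaller index ends at entry 0, so any two entries
    are joined through it. *)
Lemma range_connected (n : nat) (a : 'I_n.+1 -> G) :
  (forall i : 'I_n.+1, (0 < i)%N ->
     exists2 j : 'I_n.+1, (j < i)%N & adj (a i) (a j)) ->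
  connected_graph (induced (range a)).
Proof.
move=> link; split; first exact: inhabits (range_elt a ord0).
have to0 (i : 'I_n.+1) : exists m, walk m (range_elt a i) (range_elt a ord0).
  have [k] := ubnP (i : nat); elim: k i => // k IH i ik.
  have [i0|i_gt0] := posnP (i : nat).
    by exists 0; congr range_elt; apply: val_inj.
  have [j ji aij] := link i i_gt0.
  have [m walkj] := IH j (leq_trans ji ik).
  by exists m.+1; exists (range_elt a j).
move=> x y; rewrite -(range_indexK x) -(range_indexK y).
have [m xm] := to0 (range_index x); have [p yp] := to0 (range_index y).
by exists (m + p)%N; apply: walk_trans xm (walk_sym yp).
Qed.

Lemma ltn_ord_injective (n : nat) (a : 'I_n -> G) :
  (forall i j : 'I_n, (i < j)%N -> a i <> a j) -> injective a.
Proof.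
move=> aN i j eij.
by have [/aN/(_ eij)|/aN/(_ (esym eij))|/val_inj] := ltngtP i j.
Qed.

(** This replaces isomorphisms of induced subgraphs by pairs of tuples. Pairs [i < j] suffice
    because adjacency is symmetric and irreflexive; the tuples have [n.+1] entries, hence the bound
    [n < k]. *)
Lemma is_CH_extend (k n : nat) (a b : 'I_n.+1 -> G) :
  is_CH k G -> (n < k)%N ->
  (forall i j : 'I_n.+1, (i < j)%N ->
     [/\ a i <> a j, b i <> b j & adj (a i) (a j) <-> adj (b i) (b j)]) ->
  (forall i : 'I_n.+1, (0 < i)%N ->
     exists2 j : 'I_n.+1, (j < i)%N & adj (a i) (a j)) ->
  exists2 g : G -> G, is_aut g & forall i, g (a i) = b i.
Proof.
move=> CH nk sub link.
have aI : injective a by apply: ltn_ord_injective => i j /sub[].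
have bI : injective b by apply: ltn_ord_injective => i j /sub[].
have ab i j : adj (a i) (a j) <-> adj (b i) (b j).
  have [/sub[]//|/sub[_ _ ab]|/val_inj ->] := ltngtP i j.
    by split=> /adj_sym/ab/adj_sym.
  by split=> /adj_irrefl.
have order_k (c : 'I_n.+1 -> G) : order_le (induced (range c)) k.
  by apply: card_le_trans (range_order_le c) _; rewrite card_le_II.
have [||g [g_aut gE]] := CH _ _ (range_elt b \o @range_index _ a)
  (range_connected link) _ (order_k a) (order_k b).
- by apply: range_connected => i /link[j ji /ab]; exists j.
- split.
    exists (range_elt a \o @range_index _ b) => x /=.
      by rewrite range_eltK // range_indexK.
    by rewrite range_eltK // range_indexK.
  move=> x y; rewrite -{1}(range_indexK x) -{1}(range_indexK y).
  exact: ab.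
exists g => // i.
by rewrite -[a i]/(val (range_elt a i)) gE /= range_eltK.
Qed.

(** Both triples induce a path on three vertices, with middle vertex [u] or [u']. *)
Lemma is_CH_geodesic (u v x u' v' x' : G) : is_CH 4 G ->
  adj u v -> (nbhd u `&` sphere 2 v) x ->
  adj u' v' -> (nbhd u' `&` sphere 2 v') x' ->
  exists2 g : G -> G, is_aut g & [/\ g u = u', g v = v' & g x = x'].
Proof.
move=> CH uv /(nbhd_sphere2E _ uv)[ux nvx navx].
move=> uv' /(nbhd_sphere2E _ uv')[ux' nvx' navx'].
pose p (a b c : G) (i : 'I_3) := nth a [:: a; b; c] i.
have [|||g g_aut gE] := is_CH_extend (a := p u v x) (b := p u' v' x') CH.
- by [].
- move=> [[|[|[|//]]] i] [[|[|[|//]]] j] //= _; rewrite /p /=;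
    by split=> //; apply: adj_neq.
- by move=> [[|[|[|//]]] i] //= _; exists ord0 => //; apply: adj_sym.
exists g => //; split; first exact: (gE ord0).
  exact: (gE (@Ordinal 3 1 isT)).
exact: (gE (@Ordinal 3 2 isT)).
Qed.

(** Among [u], [v], [w], [y] every adjacency is forced except that of [y] and [w], so agreement
    there makes the two quadruples isomorphic. *)
Lemma is_CH_geodesic_nbr (u v w y y' : G) : is_CH 4 G ->
  adj u v -> (sphere 2 u `&` nbhd v) w ->
  (nbhd u `&` sphere 2 v) y -> (nbhd u `&` sphere 2 v) y' ->
  (adj y w <-> adj y' w) ->
  exists2 g : G -> G, is_aut g & [/\ g u = u, g v = v, g w = w & g y = y'].
Proof.
move=> CH uv [/sphere2E[nuw nauw _] /nbhdE vw].
move=> /(nbhd_sphere2E _ uv)[uy nvy navy].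
move=> /(nbhd_sphere2E _ uv)[uy' nvy' navy'] yw.
have wy : adj w y <-> adj w y' by split=> /adj_sym/yw/adj_sym.
have nw z : adj u z -> w <> z by move=> uz ewz; apply: nauw; rewrite ewz.
(* In this order each later entry has an earlier neighbour: [u] for [v] and [z], and [v] for [w].
   The default [u] is never reached. *)
pose p (z : G) (i : 'I_4) := nth u [:: u; v; w; z] i.
have [|||g g_aut gE] := is_CH_extend (a := p y) (b := p y') CH.
- by [].
- move=> [[|[|[|[|//]]]] i] [[|[|[|[|//]]]] j] //= _; rewrite /p /=;
    by split=> //; by [apply: adj_neq | apply: nw].
- move=> [[|[|[|[|//]]]] i] //= _.
  + by exists ord0 => //; apply: adj_sym.
  + by exists (@Ordinal 4 1 isT) => //; apply: adj_sym.
  + by exists ord0 => //; apply: adj_sym.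
exists g => //; split; first exact: (gE ord0).
- exact: (gE (@Ordinal 4 1 isT)).
- exact: (gE (@Ordinal 4 2 isT)).
- exact: (gE (@Ordinal 4 3 isT)).
Qed.

End Extension.

Unset Implicit Arguments.
Set Strict Implicit.

Theorem lemma3p6 (G : sgraph) (G_nonempty : inhabited G)
    (G_local : exists u' v' : G,
      nbhd u' v' /\
      ~ edgeless_graph (induced (nbhd u' `&` sphere 2 v')) /\
      ~ complete_graph (induced (nbhd u' `&` sphere 2 v')))
    (G_unique_x : unique_x_property G) :
  ~ is_CH 4 G.
Proof.
move=> CH.
have [_ [u [v [w [/nbhdE uv [Ww [x [[Xx Cx] x_uniq]]]]]]]] := G_unique_x.
have [u' [v' [/nbhdE uv' [edge nonedge]]]] := G_local.
(* An edge [a b] of the local graph at [u'], [v'] is carried to [u], [v] with [a] landing on [x];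
   the image of [b] is the neighbour sought. *)
have [y1 Xy1 xy1] : exists2 y, (nbhd u `&` sphere 2 v) y & adj x y.
  have [a [b [Xa Xb ab]]] := not_edgeless_induced edge.
  have [g g_aut [gu gv <-]] := is_CH_geodesic CH uv' Xa uv Xx.
  exists (g b); last by rewrite aut_adj.
  by rewrite -gu -gv; exact: aut_nbhd_sphere2.
have [y2 Xy2 [nxy2 naxy2]] :
    exists2 y, (nbhd u `&` sphere 2 v) y & x <> y /\ ~ adj x y.
  have [a [b [Xa Xb nab naab]]] := not_complete_induced nonedge.
  have [g g_aut [gu gv <-]] := is_CH_geodesic CH uv' Xa uv Xx.
  exists (g b); first by rewrite -gu -gv; exact: aut_nbhd_sphere2.
  by rewrite aut_adj //; split=> // /(aut_inj g_aut).
(* The image [g x] satisfies the conditions that single out [x], as these mention only [u], [v] and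
   [w]. *)
have fix_x (g : G -> G) :
    is_aut g -> g u = u -> g v = v -> g w = w -> g x = x.
  move=> g_aut gu gv gw; symmetry; apply: x_uniq; split.
    by have := aut_nbhd_sphere2 g_aut uv Xx; rewrite gu gv.
  by have := aut_common_nbhd g_aut Cx; rewrite gu gv gw.
have flip y : (nbhd u `&` sphere 2 v) y -> x <> y -> ~ (adj y w <-> adj x w).
  move=> Xy nxy yxw.
  have [g g_aut [gu gv gw gy]] :=
    is_CH_geodesic_nbr CH uv Ww Xy Xx yxw.
  apply: nxy; apply: (aut_inj g_aut).
  by rewrite gy; exact: fix_x.
(* Both differ from [x] in their adjacency to [w], which has only two possible truth values. *)
have y12 : adj y1 w <-> adj y2 w.
  have := flip _ Xy1 (adj_neq xy1); have := flip _ Xy2 nxy2.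
  by have [?|?] := pselect (adj x w); have [?|?] := pselect (adj y1 w);
     have [?|?] := pselect (adj y2 w); tauto.
(* This [g] fixes [x] and sends [y1] to [y2], so it would carry the edge [x y1] to the non-edge
   [x y2]. *)
have [g g_aut [gu gv gw gy]] :=
  is_CH_geodesic_nbr CH uv Ww Xy1 Xy2 y12.
apply: naxy2; rewrite -gy -(fix_x g g_aut gu gv gw).
by rewrite aut_adj.
Qed.
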